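(* Let $f:\mathbb{R}^{2}\to\mathbb{R}$ be a smooth convex function with a unique minimum (i.e. $f$ attains its minimum at exactly one point). Then the trajectories $\gamma$ of the gradient system $$\dot{\gamma}(t)=-\nabla f(\gamma(t))$$ have finite length.
   Context: A trajectory is a maximal forward solution $\gamma:[0,T)\to\mathbb{R}^2$ of the gradient system with some initial condition $\gamma(0)=x_0\in\mathbb{R}^2$. The length of a curve $\gamma:I\to\mathbb{R}^n$ is the supremum of $\sum_{i=1}^{k}\|\gamma(t_{i})-\gamma(t_{i+1})\|$ over all finite subdivisions $t_1<\dots<t_{k+1}$ of $I$, where $\|\cdot\|$ is the Euclidean norm. *)

(* Defs.v *)
From HB Require Import structures.
From mathcomp Require Import all_boot all_order all_algebra.
From mathcomp Require Import all_classical all_reals all_analysis.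

Set Implicit Arguments.
Unset Strict Implicit.
Unset Printing Implicit Defensive.

Import Order.TTheory GRing.Theory Num.Theory.
Import numFieldNormedType.Exports.

Local Open Scope classical_set_scope.
Local Open Scope ring_scope.

(* The library norm on 'rV[R]_n is the max norm, not the Euclidean one. *)
Definition euclidean_norm (R : realType) (n : nat) (v : 'rV[R]_n) : R :=
  Num.sqrt (\sum_(i < n) v 0 i ^+ 2).

Definition partial (R : realType) (n : nat) (i : 'I_n) (f : 'rV[R]_n -> R)
  : 'rV[R]_n -> R := 'D_(delta_mx 0 i) f.

Definition gradient (R : realType) (n : nat) (f : 'rV[R]_n -> R)
  (x : 'rV[R]_n) : 'rV[R]_n := \row_(i < n) partial i f x.

(* The partial derivatives of order at most k exist and are continuous. *)
Fixpoint Ck (R : realType) (n k : nat) (f : 'rV[R]_n -> R) : Prop :=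
  continuous f /\
  match k with
  | 0%N => True
  | k'.+1 => forall i : 'I_n,
      (forall x, derivable f x (delta_mx 0 i)) /\ Ck k' (partial i f)
  end.

Definition smooth (R : realType) (n : nat) (f : 'rV[R]_n -> R) : Prop :=
  forall k : nat, Ck k f.

Definition unique_minimum (R : realType) (T : Type) (f : T -> R) : Prop :=
  exists! x : T, forall y : T, f x <= f y.

(* [0, T) for T : \bar R, so that T = +oo is allowed. *)
Definition forward_itv (R : realType) (T : \bar R) : set R :=
  [set t | 0 <= t /\ (t%:E < T)%E].

(* Derivative relative to I: two-sided at interior points of I, one-sided at
   an endpoint belonging to I.  The punctured filter 0^' excludes h = 0. *)
Definition has_derivative_within (R : realType) (n : nat) (I : set R)
  (g : R -> 'rV[R]_n) (t : R) (v : 'rV[R]_n) : Prop :=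
  h^-1 *: (g (t + h) - g t) @[h --> within [set h | I (t + h)] 0^'] --> v.

(* Only the values of g on [0, T) are relevant. *)
Definition gradient_solution (R : realType) (n : nat) (f : 'rV[R]_n -> R)
  (T : \bar R) (g : R -> 'rV[R]_n) : Prop :=
  (0 < T)%E /\
  forall t, forward_itv T t ->
    has_derivative_within (forward_itv T) g t (- gradient f (g t)).

Definition trajectory (R : realType) (n : nat) (f : 'rV[R]_n -> R)
  (T : \bar R) (g : R -> 'rV[R]_n) : Prop :=
  gradient_solution f T g /\
  forall (T' : \bar R) (g' : R -> 'rV[R]_n),
    (T <= T')%E -> gradient_solution f T' g' ->
    (forall t, forward_itv T t -> g' t = g t) -> T' = T.

(* Subdivisions are t 0 < ... < t k in I; later values of t are ignored.  The
   degenerate case k = 0 contributes the sum 0. *)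
Definition curve_length (R : realType) (n : nat) (I : set R)
  (g : R -> 'rV[R]_n) : \bar R :=
  ereal_sup [set l : \bar R | exists (k : nat) (t : nat -> R),
    [/\ forall i, (i <= k)%N -> I (t i),
        forall i, (i < k)%N -> t i < t i.+1 &
        l = (\sum_(i < k) euclidean_norm (g (t i) - g (t i.+1)))%:E]].

(* Main.v *)
Require Import Defs.
From mathcomp Require Import all_boot all_order all_algebra.
From mathcomp Require Import all_classical all_reals all_analysis.
From mathcomp Require Import ring lra.
Import numFieldNormedType.Exports.

(** A trajectory of the gradient flow of a convex function is self-contracted:
    for [s <= t <= u], [g t] is at least as close to [g u] as [g s] is.  Indeed
    the derivative of [|g r - w|^2] is [2 <grad f (g r), w - g r>], which by
    convexity is at most [2 (f w - f (g r))]; with [w = g u] this is nonpositive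
    as long as [r <= u], because [f] decreases along the flow
    ([solution_dist_nonincreasing], [solution_value_nonincreasing]).  Taking the
    minimizer of [f] for [w] shows that the trajectory is bounded.

    It remains to see that a bounded self-contracted planar curve has finite
    length ([self_contracted_bounded_length]).  By self-contractedness the
    vectors [g u - g s], [u >= s], make pairwise angles of at most 90 degrees
    (this is [self_contracted_acute]), hence they lie in a quadrant.  Its
    bisector is within 22.5 degrees of the axis of one of eight fixed cones, so
    that one of eight fixed directions [d] satisfies
    [<g u - g s, d> >= c |g u - g s|] for a universal [c > 0]
    ([acute_common_direction]).  Let [m d t] be the infimum of [<g u, d>] over
    the tail [u >= t].  Each of these eight functions is nondecreasing and
    bounded, and a step of the curve from [s] to [t] increases one of them by at
    least a fixed fraction of [|g t - g s|] ([self_contracted_step]).  The sum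
    of all steps of a subdivision is therefore bounded by a multiple of the
    total increase of the eight functions.

    That [f] decreases along the flow is again a consequence of convexity: the
    gradient inequality at [g t] and at [g (t + h)] encloses the difference
    quotient of [f] along the curve between two quantities with the common limit
    [-|grad f|^2] ([is_derive_f_solution]). *)

Import Order.TTheory GRing.Theory Num.Theory.

Set Implicit Arguments.
Unset Strict Implicit.
Unset Printing Implicit Defensive.

Local Open Scope classical_set_scope.
Local Open Scope ring_scope.

(** * Acute planar sets *)

(** Three of the eight cones of opening 135 degrees bounded by multiples of 45
    degrees suffice once a point of the set is known to lie in the octant
    [0 <= b <= a].  A point [(p, q)] outside the first cone has left it through
    one of its two sides; as the set makes angles of at most 90 degrees with
    [(p, q)] and with [(a, b)], it then lies in the neighbouring cone on that
    side. *)
Lemma quadrant_octant (R : realDomainType) (S : set (R * R)) (a b : R) :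
  (forall u v, S u -> S v -> 0 <= u.1 * v.1 + u.2 * v.2) ->
  S (a, b) -> 0 <= b -> b <= a -> 0 < a ->
  [\/ forall u, S u -> 0 <= u.1 /\ 0 <= u.1 + u.2,
      forall u, S u -> 0 <= u.2 /\ 0 <= u.1 + u.2 |
      forall u, S u -> 0 <= u.1 /\ 0 <= u.1 - u.2].
Proof.
move=> Sacute Sab b0 ba a0.
have [all_sum|/existsNP[[p q]]] := pselect (forall u, S u -> 0 <= u.1 + u.2).
  have [all_x|/existsNP[[p q]]] := pselect (forall u, S u -> 0 <= u.1).
    by apply: Or31 => u Su; split; [exact: all_x|exact: all_sum].
  move=> /not_implyP[Spq /negP]; rewrite -ltNge/= => p0.
  apply: Or32 => -[x y] Sxy; have /= := all_sum _ Sxy; split=> //.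
  have /= Hu := Sacute _ _ Spq Sxy; have /= Hv := Sacute _ _ Sab Sxy.
  have /= := all_sum _ Spq => pq0.
  rewrite leNgt; apply/negP => y0.
  have x0 : 0 < x by nra.
  nra.
move=> /not_implyP[Spq /negP]; rewrite -ltNge/= => pq0.
apply: Or33 => -[x y] Sxy /=.
have /= Hu := Sacute _ _ Spq Sxy; have /= Hv := Sacute _ _ Sab Sxy.
have /= Hw := Sacute _ _ Sab Spq.
have p0 : 0 <= p.
  rewrite leNgt; apply/negP => p0; have [q0|q0] := ltP q 0; nra.
have q0 : q < 0 by nra.
have x0 : 0 <= x.
  rewrite leNgt; apply/negP => x0.
  have y0 : 0 < y by nra.
  nra.
split=> //; nra.
Qed.

(** The eight directions [(+-1, +-2)] and [(+-2, +-1)], close to the bisectors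
    of the eight cones of opening 135 degrees and with integer coordinates. *)
Definition dir (R : realDomainType) (i : bool * bool * bool) : R * R :=
  ((-1) ^+ i.1.1 * (if i.2 then 1 else 2),
   (-1) ^+ i.1.2 * (if i.2 then 2 else 1)).

(** The dihedral symmetries of the square permute the eight directions and
    preserve both the acuteness hypothesis and the l1 norm, so that
    [quadrant_octant] may be applied in the octant of any nonzero element. *)
Lemma acute_common_direction (R : realDomainType) (S : set (R * R)) :
  (forall u v, S u -> S v -> 0 <= u.1 * v.1 + u.2 * v.2) ->
  exists i, forall u, S u ->
    `|u.1| + `|u.2| <= 2 * ((dir R i).1 * u.1 + (dir R i).2 * u.2).
Proof.
move=> Sacute.
have [all0|/existsNP[[a b]]] := pselect (forall u, S u -> u = 0).
  exists (true, true, true) => u /all0 -> /=.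
  by rewrite !normr0 !mulr0 addr0 mulr0.
move=> /not_implyP[Sab /eqP ab0].
wlog ba : S Sacute a b Sab ab0 / `|b| <= `|a|.
  move=> wlg; have [|/ltW ab] := leP `|b| `|a|; first exact: (wlg S Sacute).
  have [u v Su Sv| | |[[s t] c] H] :=
      wlg [set w : R * R | S (w.2, w.1)] _ b a _ _ ab.
  - by rewrite addrC; exact: (Sacute _ _ Su Sv).
  - exact: Sab.
  - by apply: contra_neq ab0 => -[-> ->].
  exists (t, s, ~~ c) => -[x y] Sxy; move: (H (y, x) Sxy) => /=.
  by rewrite addrC [X in 2 * X]addrC if_neg; case: c {H}.
have a0 : 0 < `|a|.
  rewrite normr_gt0; apply: contra_neq ab0 => a0.
  by move: ba; rewrite a0 normr0 normr_le0 => /eqP ->.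
set s := a < 0; set t := b < 0.
have signM (c : bool) (x y : R) : (-1) ^+ c * x * ((-1) ^+ c * y) = x * y.
  by rewrite mulrACA -expr2 sqrr_sign mul1r.
have signK (c : bool) (x : R) : (-1) ^+ c * ((-1) ^+ c * x) = x.
  by rewrite mulrA -expr2 sqrr_sign mul1r.
have normS (c : bool) (x : R) : `|(-1) ^+ c * x| = `|x|.
  by rewrite normrM normr_sign mul1r.
(* Reflecting in the axes brings the point (a, b) into the octant. *)
pose S' := [set w : R * R | S ((-1) ^+ s * w.1, (-1) ^+ t * w.2)].
have S'acute u v : S' u -> S' v -> 0 <= u.1 * v.1 + u.2 * v.2.
  by move=> Su Sv; have /= := Sacute _ _ Su Sv; rewrite !signM.
have toS' u : S u -> S' ((-1) ^+ s * u.1, (-1) ^+ t * u.2).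
  by case: u => x y; rewrite /S'/= !signK.
have S'ab : S' (`|a|, `|b|) by rewrite /S'/= !mulr_sign_norm.
have cone (x y : R) :
   [/\ (0 <= x -> 0 <= x + y -> `|x| + `|y| <= 2 * (2 * x + y)),
       (0 <= y -> 0 <= x + y -> `|x| + `|y| <= 2 * (x + 2 * y)) &
       (0 <= x -> 0 <= x - y -> `|x| + `|y| <= 2 * (2 * x - y))].
  by split; have [] := ger0P x; have [] := ger0P y; lra.
have coneS (u : R * R) := cone ((-1) ^+ s * u.1) ((-1) ^+ t * u.2).
case: (quadrant_octant S'acute S'ab (normr_ge0 b) ba a0) => H.
- exists (s, t, false) => u /toS' /H /= [h1 h2].
  have [c _ _] := coneS u.
  by move: (c h1 h2); rewrite !normS => /le_trans; apply; lra.
- exists (s, t, true) => u /toS' /H /= [h1 h2].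
  have [_ c _] := coneS u.
  by move: (c h1 h2); rewrite !normS => /le_trans; apply; lra.
- exists (s, ~~ t, false) => u /toS' /H /= [h1 h2].
  have [_ _ c] := coneS u.
  by move: (c h1 h2); rewrite !normS signrN => /le_trans; apply; lra.
Qed.

(** * Self-contracted planar curves *)

Definition dot (R : realType) (n : nat) (u v : 'rV[R]_n) : R :=
  \sum_(i < n) u 0 i * v 0 i.

Lemma dot2E (R : realType) (u v : 'rV[R]_2) :
  dot u v = u 0 0 * v 0 0 + u 0 1 * v 0 1.
Proof.
rewrite /dot !big_ord_recl big_ord0 addr0.
by congr (_ + u 0 _ * v 0 _); apply/val_inj.
Qed.

Lemma euclidean_norm_ge0 (R : realType) (n : nat) (v : 'rV[R]_n) :
  0 <= euclidean_norm v.
Proof. exact: sqrtr_ge0. Qed.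

Lemma sqr_euclidean_norm (R : realType) (n : nat) (v : 'rV[R]_n) :
  euclidean_norm v ^+ 2 = dot v v.
Proof.
rewrite /euclidean_norm sqr_sqrtr.
  by apply: eq_bigr => i _; rewrite expr2.
by apply: sumr_ge0 => i _; exact: sqr_ge0.
Qed.

Lemma le_euclidean_norm (R : realType) (n : nat) (u v : 'rV[R]_n) :
  (euclidean_norm u <= euclidean_norm v) = (dot u u <= dot v v).
Proof.
by rewrite -!sqr_euclidean_norm ler_pXn2r// nnegrE euclidean_norm_ge0.
Qed.

Lemma euclidean_norm_le_l1 (R : realType) (v : 'rV[R]_2) :
  euclidean_norm v <= `|v 0 0| + `|v 0 1|.
Proof.
rewrite -(ler_pXn2r (ltn0Sn 1)) ?nnegrE ?addr_ge0 ?euclidean_norm_ge0//.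
rewrite sqr_euclidean_norm dot2E -!expr2 -[v 0 0 ^+ 2]real_normK ?num_real//.
rewrite -[v 0 1 ^+ 2]real_normK ?num_real//.
by rewrite sqrrD lerD2r lerDl mulrn_wge0// mulr_ge0.
Qed.

Lemma coord_le_euclidean_norm (R : realType) (n : nat) (v : 'rV[R]_n) i :
  `|v 0 i| <= euclidean_norm v.
Proof.
rewrite -sqrtr_sqr ler_wsqrtr// (bigD1 i)//= lerDl.
by apply: sumr_ge0 => j _; exact: sqr_ge0.
Qed.

Definition self_contracted (R : realType) (n : nat) (I : set R)
    (g : R -> 'rV[R]_n) : Prop :=
  forall s t u, I s -> I t -> I u -> s <= t -> t <= u ->
    euclidean_norm (g t - g u) <= euclidean_norm (g s - g u).

Definition along (R : realType) (i : bool * bool * bool) (v : 'rV[R]_2) : R :=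
  (dir R i).1 * v 0 0 + (dir R i).2 * v 0 1.

Lemma alongD (R : realType) i (u v : 'rV[R]_2) :
  along i (u + v) = along i u + along i v.
Proof. by rewrite /along !mxE; ring. Qed.

Lemma le_along (R : realType) i (v : 'rV[R]_2) :
  `|along i v| <= 3 * euclidean_norm v.
Proof.
have h0 := coord_le_euclidean_norm v 0; have h1 := coord_le_euclidean_norm v 1.
rewrite /along (le_trans (ler_normD _ _))//=.
by rewrite !normrM !normr_sign !mul1r; case: i.2; rewrite normr1 normr_nat; lra.
Qed.

(** Expanding [|(g t - g s) - (g u - g s)|^2 <= |g u - g s|^2].  Besides
    acuteness this gives [|g t - g s| <= 2 |g u - g s|]: the tail from [t] on
    stays away from [g s]. *)
Lemma self_contracted_acute (R : realType) (n : nat) (I : set R)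
    (g : R -> 'rV[R]_n) s t u : self_contracted I g ->
  I s -> I t -> I u -> s <= t -> t <= u ->
  dot (g t - g s) (g t - g s) <= 2 * dot (g t - g s) (g u - g s).
Proof.
move=> sc Is It Iu st tu; have := sc _ _ _ Is It Iu st tu.
rewrite le_euclidean_norm /dot -subr_ge0 -sumrB => h.
rewrite -subr_ge0 mulr_sumr -sumrB; apply: le_trans h _.
by apply: ler_sum => i _; rewrite !mxE; lra.
Qed.

(** The direction is chosen once for the whole tail, before [u]: this is what
    makes the infimum over the tail increase. *)
Lemma self_contracted_step (R : realType) (I : set R)
    (g : R -> 'rV[R]_2) s t : self_contracted I g ->
  I s -> I t -> s <= t ->
  exists i, forall u, I u -> t <= u ->
    euclidean_norm (g s - g t) <= 4 * (along i (g u) - along i (g s)).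
Proof.
move=> sc Is It st.
pose S : set (R * R) := [set w | exists2 u, I u /\ t <= u &
  w = ((g u - g s) 0 0, (g u - g s) 0 1)].
have [_ _ [u [Iu tu] ->] [v [Iv tv] ->]|i Hi] := @acute_common_direction R S.
  rewrite /= -dot2E.
  wlog uv : u v Iu Iv tu tv / u <= v.
    move=> H; have [|/ltW] := leP u v; first exact: H.
    by move=> vu; rewrite /dot; under eq_bigr do rewrite mulrC; exact: H.
  have := self_contracted_acute sc Is Iu Iv (le_trans st tu) uv.
  by rewrite -sqr_euclidean_norm => /(le_trans (sqr_ge0 _)); rewrite pmulr_rge0.
exists i => u Iu tu.
have half : euclidean_norm (g s - g t) <= 2 * euclidean_norm (g u - g s).
  have -> : euclidean_norm (g s - g t) = euclidean_norm (g t - g s).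
    congr Num.sqrt; apply: eq_bigr => j _.
    by rewrite !mxE -sqrrN opprB.
  have := self_contracted_acute sc Is It Iu st tu.
  (* From |a|^2 <= 2 <a, b> and |2b - a|^2 >= 0. *)
  set a := g t - g s; set b := g u - g s => ab.
  rewrite -(ler_pXn2r (ltn0Sn 1)) ?nnegrE ?mulr_ge0 ?euclidean_norm_ge0//.
  rewrite exprMn !sqr_euclidean_norm.
  have : 0 <= dot (2 *: b - a) (2 *: b - a).
    by rewrite -sqr_euclidean_norm sqr_ge0.
  by move: ab; rewrite !dot2E !mxE; lra.
have := Hi _ (ex_intro2 _ _ u (conj Iu tu) erefl).
move/(le_trans (euclidean_norm_le_l1 _)).
rewrite -/(along i (g u - g s)).
have -> : along i (g u) = along i (g u - g s) + along i (g s).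
  by rewrite -alongD subrK.
by lra.
Qed.

(** The sum [Phi] over the eight directions of the infima over the tail is a
    monotone potential of bounded variation, and it controls the increments of
    the curve. *)
Lemma self_contracted_bounded_length (R : realType) (I : set R)
    (g : R -> 'rV[R]_2) c M : self_contracted I g ->
  (forall t, I t -> euclidean_norm (g t - c) <= M) ->
  (curve_length I g < +oo)%E.
Proof.
move=> sc gM.
pose tail i t := [set along i (g u) | u in [set u | I u /\ t <= u]].
pose m i t := inf (tail i t).
have gB i u : I u -> along i c - 3 * M <= along i (g u) <= along i c + 3 * M.
  move=> Iu; have -> : along i (g u) = along i (g u - c) + along i c.
    by rewrite -alongD subrK.
  have := le_trans (le_along i (g u - c)) (ler_wpM2l (ler0n _ 3) (gM u Iu)).
  by rewrite ler_norml => /andP[]; lra.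
have tail_lb i t : has_lbound (tail i t).
  by exists (along i c - 3 * M) => _ [u [Iu _] <-]; case/andP: (gB i u Iu).
have tail_self i t : I t -> tail i t (along i (g t)) by move=> It; exists t.
have m_le i t : I t -> m i t <= along i (g t).
  by move=> It; apply: ge_inf; [exact: tail_lb|exact: tail_self].
have m_ge i t x : I t ->
    (forall u, I u -> t <= u -> x <= along i (g u)) -> x <= m i t.
  move=> It h; apply: lb_le_inf.
    by exists (along i (g t)); exact: tail_self.
  by move=> _ [u [Iu tu] <-]; exact: h.
have m_mono i s t : I s -> I t -> s <= t -> m i s <= m i t.
  move=> Is It st; apply: m_ge => // u Iu tu.
  by apply: ge_inf => //; exists u => //; split => //; exact: le_trans tu.
pose Phi t := \sum_i m i t.
have step s t : I s -> I t -> s <= t ->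
    euclidean_norm (g s - g t) <= 4 * (Phi t - Phi s).
  move=> Is It st; have [i Hi] := self_contracted_step sc Is It st.
  rewrite /Phi -sumrB (bigD1 i)//=.
  have : along i (g s) + euclidean_norm (g s - g t) / 4 <= m i t.
    by apply: m_ge => // u Iu tu; have := Hi u Iu tu; lra.
  have : 0 <= \sum_(j | j != i) (m j t - m j s).
    by apply: sumr_ge0 => j _; rewrite subr_ge0 m_mono.
  by have := m_le i s Is; lra.
have PhiB s t : I s -> I t ->
    Phi t - Phi s <= \sum_(i : bool * bool * bool) 6 * M.
  move=> Is It; rewrite /Phi -sumrB; apply: ler_sum => i _.
  have := m_le i t It; have /andP[_] := gB i t It.
  have : along i c - 3 * M <= m i s.
    by apply: m_ge => // u Iu _; case/andP: (gB i u Iu).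
  by lra.
apply: (@le_lt_trans _ _ (4 * \sum_(i : bool * bool * bool) 6 * M)%:E);
  last exact: ltry.
apply: ge_ereal_sup => _ [k [t [It tlt ->]]]; rewrite lee_fin.
apply: (@le_trans _ _ (\sum_(i < k) 4 * (Phi (t i.+1) - Phi (t i)))).
  apply: ler_sum => i _.
  by apply: step; [apply: It|apply: It|apply/ltW/tlt] => //; exact: ltnW.
rewrite -mulr_sumr ler_pM2l//.
rewrite -(big_mkord xpredT (fun i => Phi (t i.+1) - Phi (t i))).
by rewrite telescope_sumr// PhiB//; exact: It.
Qed.

(** * Convex functions with partial derivatives *)

Lemma convex_functionE (R : realType) (n : nat) (f : 'rV[R]_n -> R) p x y :
  convex_function [set: 'rV[R]_n] f -> 0 <= p <= 1 ->
  f (p *: x + (1 - p) *: y) <= p * f x + (1 - p) * f y.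
Proof.
move=> cf /andP[p0 p1].
by have := cf (Itv01 p0 p1) x y; rewrite !inE; apply.
Qed.

(** Derivatives in a direction [a *: e_i] are needed for every real [a],
    including [0]. *)
Lemma is_derive_line (R : realType) (n : nat) (f : 'rV[R]_n -> R) i x a :
  derivable f x (delta_mx 0 i) ->
  is_derive (0 : R) 1 (fun h => f ((h * a) *: delta_mx 0 i + x))
    (a * partial i f x).
Proof.
move=> dfx.
have d1 : is_derive (0 * a : R) 1 (fun h => f (h *: delta_mx 0 i + x))
    (partial i f x).
  rewrite mul0r; split.
    by move/derivable1P : dfx.
  rewrite /partial /derive; congr (lim (_ @ 0^')); apply/funext => h /=.
  by rewrite scale0r add0r addr0 [h%:A]mulr1.
have d2 : is_derive (0 : R) 1 (fun h => h * a) a.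
  have h := @is_deriveM R _ id (cst a) (0:R) 1 1 0 _ _.
  apply: is_derive_eq.
  by rewrite scaler0 add0r /GRing.scale /= mulr1.
rewrite mulrC.
exact: (@is_derive1_comp R _ (fun h => h * a) 0 _ _ d1 d2).
Qed.

Lemma is_derive_cvg (R : realType) (V : normedModType R) (F : R -> V)
    (x : R) (l : V) :
  is_derive x 1 F l <-> h^-1 *: (F (x + h) - F x) @[h --> 0^'] --> l.
Proof.
have E : (fun h : R => h^-1 *: ((F \o shift x) (h *: 1) - F x)) =
         (fun h => h^-1 *: (F (x + h) - F x)).
  by apply/funext => h /=; rewrite [h%:A]mulr1 [h + x]addrC.
split=> [[dF <-]|cF]; first by rewrite -E.
split; first by apply/cvg_ex; exists l; rewrite /= E.
by apply: cvg_lim => //; rewrite E.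
Qed.

(** The gradient inequality, from the partial derivatives alone: [x] lies
    between [y] and [x - h *: (y - x)], and the latter is the midpoint of two
    points obtained from [x] by moving along one axis each.  Two applications of
    convexity bound [f y - f x] from below by difference quotients along the
    axes. *)
Lemma convex_gradient_le (R : realType) (f : 'rV[R]_2 -> R) :
  (forall i x, derivable f x (delta_mx 0 i)) ->
  convex_function [set: 'rV[R]_2] f ->
  forall x y, dot (gradient f x) (y - x) <= f y - f x.
Proof.
move=> df cf x y; set v := y - x.
pose L (i : 'I_2) (h : R) := f ((h * (-2 * v 0 i)) *: delta_mx 0 i + x).
have dL (i : 'I_2) := is_derive_line (-2 * v 0 i) (df i x).
have cL (i : 'I_2) : h^-1 * (L i h - f x) @[h --> 0^'+] -->
    -2 * v 0 i * partial i f x.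
  apply: cvg_dnbhs_at_right.
  have /is_derive_cvg := dL i.
  by under eq_fun do rewrite add0r mul0r scale0r add0r.
have cvgH : - (h^-1 * (L 0 h - f x) + h^-1 * (L 1 h - f x)) / 2 @[h --> 0^'+]
    --> dot (gradient f x) v.
  have -> : dot (gradient f x) v =
     - (-2 * v 0 0 * partial 0 f x + -2 * v 0 1 * partial 1 f x) / 2.
    by rewrite dot2E !mxE; field.
  have cN := cvgN (cvgD (cL 0) (cL 1)).
  by apply: cvgM; [exact: cN|exact: cvg_cst].
apply: (cvgr_to_le cvgH); near=> h.
have h0 : 0 < h by near: h; exact: nbhs_right_gt.
have xE : x = (h / (1 + h)) *: y + (1 - h / (1 + h)) *: (x - h *: v).
  apply/rowP => i; rewrite !mxE; field; lra.
have mid : x - h *: v = 2^-1 *: ((h * (-2 * v 0 0)) *: delta_mx 0 0 + x) +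
    (1 - 2^-1) *: ((h * (-2 * v 0 1)) *: delta_mx 0 1 + x).
  apply/rowP => i; have [->|->] : i = 0 \/ i = 1.
  - by case: i => -[|[|//]] ?; [left|right]; apply/val_inj.
  - by rewrite !mxE /=; field.
  - by rewrite !mxE /=; field.
have h1 : f (x - h *: v) <= (L 0 h + L 1 h) / 2.
  rewrite mid; apply: le_trans (convex_functionE _ _ cf _) _; first lra.
  rewrite /L; lra.
have : f x <= h / (1 + h) * f y + (1 - h / (1 + h)) * f (x - h *: v).
  rewrite {1}xE; apply: convex_functionE => //.
  by rewrite divr_ge0 ?ler_pdivrMr; lra.
have -> : 1 - h / (1 + h) = 1 / (1 + h) by field; lra.
move=> h2.
have h3 : (1 + h) * f x <= h * f y + (L 0 h + L 1 h) / 2.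
  have : (1 + h) * f x <= h * f y + f (x - h *: v).
    by rewrite mulrC -ler_pdivlMr; [apply: le_trans h2 _; lra|lra].
  by lra.
rewrite -(ler_pM2l h0).
have -> : h * (- (h^-1 * (L 0 h - f x) + h^-1 * (L 1 h - f x)) / 2) =
   - ((L 0 h - f x) + (L 1 h - f x)) / 2 by field; lra.
lra.
Unshelve. all: by end_near. Qed.

(** * The gradient flow *)

Lemma forward_itv_le (R : realType) (T : \bar R) (s t : R) :
  0 <= s -> s <= t -> forward_itv T t -> forward_itv T s.
Proof.
by move=> s0 st [_ tT]; split=> //; apply: le_lt_trans tT; rewrite lee_fin.
Qed.

(** Openness on the right of [0, T): every positive time of [0, T) is interior,
    so the derivative within [0, T) is two-sided there. *)
Lemma forward_itv_right (R : realType) (T : \bar R) (t : R) :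
  forward_itv T t -> exists2 e, 0 < e & forward_itv T (t + e).
Proof.
case: T => [r [t0]||[]//].
- rewrite lte_fin => tr; exists ((r - t) / 2); first lra.
  by split; [lra|rewrite lte_fin; lra].
- by move=> [t0 _]; exists 1 => //; split; [lra|exact: ltry].
Qed.

Lemma within_near_cvg (R : realType) (V : topologicalType) (F G : set_system R)
    (D : set R) (q : R -> V) (l : V) : Filter F -> F `=>` G ->
  F D -> q h @[h --> within D G] --> l -> q h @[h --> F] --> l.
Proof.
move=> FF FG FD; apply: cvg_trans => U DU.
by apply: (@filterS2 _ F FF D _ _ _ FD (FG _ DU)) => h Dh; apply.
Qed.

Lemma solution_is_derive (R : realType) (n : nat) (f : 'rV[R]_n -> R) T g t :
  gradient_solution f T g -> 0 < t -> forward_itv T t ->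
  is_derive t 1 g (- gradient f (g t)).
Proof.
move=> [_ sol] t0 It; apply/is_derive_cvg.
have [e e0 Ie] := forward_itv_right It.
have inI : \forall h \near (0:R)^', forward_itv T (t + h).
  near=> h.
  have he : `|h| < Num.min e t by near: h; apply: dnbhs0_lt; rewrite lt_min e0.
  move: he; rewrite lt_min !ltr_norml => /andP[/andP[? ?] /andP[? ?]].
  by apply: forward_itv_le Ie; lra.
exact: (within_near_cvg _ (fun _ => id) inI (sol t It)).
Unshelve. all: by end_near. Qed.

Lemma solution_right_continuous (R : realType) (n : nat)
    (f : 'rV[R]_n -> R) T g :
  gradient_solution f T g -> g h @[h --> 0^'+] --> g 0.
Proof.
move=> [T0 sol].
have I0 : forward_itv T 0 by split.
pose q h := h^-1 *: (g (0 + h) - g 0).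
have cq := sol _ I0; rewrite /has_derivative_within -/q in cq.
have [e e0 Ie] := forward_itv_right I0.
have cq' : q h @[h --> 0^'+] --> - gradient f (g 0).
  apply: (within_near_cvg _ _ _ cq).
    by apply: within_subset => r r0; rewrite gt_eqF.
  near=> h.
  have h0 : 0 < h by near: h; exact: nbhs_right_gt.
  have he : h <= e by near: h; exact: nbhs_right_le.
  by apply: forward_itv_le Ie; lra.
have ch : h *: q h @[h --> (0:R)^'+] --> 0 *: - gradient f (g 0).
  apply: cvgZ; last exact: cq'.
  by apply: cvg_at_right_filter; exact: cvg_id.
have : g 0 + h *: q h @[h --> (0:R)^'+] --> g 0 + 0 *: - gradient f (g 0).
  by apply: cvgD; [exact: cvg_cst|exact: ch].
rewrite scale0r addr0; apply: cvg_trans; apply: near_eq_cvg.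
near=> h.
have h0 : 0 < h by near: h; exact: nbhs_right_gt.
by rewrite /q /= add0r scalerA divff ?gt_eqF// scale1r addrC subrK.
Unshelve. all: by end_near. Qed.

Lemma is_derive_continuous (R : realType) (V : normedModType R) (g : R -> V)
    (t : R) (v : V) : is_derive t 1 g v -> {for t, continuous g}.
Proof.
by move=> [dg _]; apply/differentiable_continuous/derivable1_diffP.
Qed.

Lemma cvg_shift_dnbhs (R : realType) (V : topologicalType) (g : R -> V)
    (t : R) :
  {for t, continuous g} -> g (t + h) @[h --> 0^'] --> g t.
Proof.
move=> cg.
have cth : t + h @[h --> (0:R)^'] --> t.
  rewrite -[X in _ --> X]addr0; apply: cvgD; first exact: cvg_cst.
  exact: nbhs_dnbhs.
exact: (@cvg_comp _ _ _ _ g _ _ _ cth).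
Qed.

(** The derivative is only required at positive times before [t]; the endpoints
    are handled by continuity, at [0] by [solution_right_continuous]. *)
Lemma solution_lyapunov (R : realType) (n : nat) (f : 'rV[R]_n -> R) T g
    (F : 'rV[R]_n -> R) (l : R -> R) t : gradient_solution f T g ->
  continuous F -> forward_itv T t ->
  (forall r, 0 < r -> r < t -> is_derive r 1 (F \o g) (l r) /\ l r <= 0) ->
  forall s, 0 <= s -> s <= t -> F (g t) <= F (g s).
Proof.
move=> sol cF It dF s s0 st.
have [t0|t0] := ltP 0 t; last first.
  have -> // : t = s by lra.
apply: (@ler0_derive1_le_cc R (F \o g) 0 t); rewrite ?in_itv/=; try lra.
- by move=> r /andP[r0 rt]; have [[]] := dF r r0 rt.
- by move=> r /andP[r0 rt]; rewrite derive1E; have [[_ ->]] := dF r r0 rt.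
have cFg r : 0 < r -> r <= t -> {for r, continuous (F \o g)}.
  move=> r0 rt; apply: continuous_comp; last exact: cF.
  have Ir : forward_itv T r by apply: forward_itv_le It; lra.
  exact: is_derive_continuous (solution_is_derive sol r0 Ir).
apply/(continuous_within_itvP _ t0); split.
- by move=> r /[!in_itv]/= /andP[r0 /ltW rt]; exact: cFg.
- by apply: (cvg_comp _ _ (solution_right_continuous sol)); exact: cF.
- by apply: cvg_at_left_filter; exact: cFg.
Qed.

Lemma cvg_coord (R : realType) (n : nat) (I : Type) (F : set_system I)
    (u : I -> 'rV[R]_n) (u0 : 'rV[R]_n) i : Filter F ->
  u x @[x --> F] --> u0 -> u x 0 i @[x --> F] --> u0 0 i.
Proof.
move=> FF cu; apply: (@cvg_comp _ _ _ u (fun M : 'rV[R]_n => M 0 i) _ _ _ cu).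
exact: coord_continuous.
Qed.

Lemma dotZr (R : realType) (n : nat) a (u v : 'rV[R]_n) :
  dot u (a *: v) = a * dot u v.
Proof.
by rewrite /dot mulr_sumr; apply: eq_bigr => i _; rewrite mxE mulrCA.
Qed.

Lemma cvg_dot (R : realType) (n : nat) (I : Type) (F : set_system I)
    (u v : I -> 'rV[R]_n) (u0 v0 : 'rV[R]_n) : Filter F ->
  (forall i, u x 0 i @[x --> F] --> u0 0 i) ->
  (forall i, v x 0 i @[x --> F] --> v0 0 i) ->
  dot (u x) (v x) @[x --> F] --> dot u0 v0.
Proof.
move=> FF cu cv; apply: cvg_big => [|i _]; first exact: add_continuous.
exact: cvgM.
Qed.

(** Squeezing replaces the chain rule: with [D = g (t + h) - g t], the gradient
    inequality at both ends places [f (g (t + h)) - f (g t)] between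
    [<grad f (g t), D>] and [<grad f (g (t + h)), D>]. *)
Lemma is_derive_f_solution (R : realType) (f : 'rV[R]_2 -> R) T g t :
  (forall i x, derivable f x (delta_mx 0 i)) ->
  (forall i, continuous (partial i f)) ->
  convex_function [set: 'rV[R]_2] f ->
  gradient_solution f T g -> 0 < t -> forward_itv T t ->
  is_derive t 1 (f \o g) (- dot (gradient f (g t)) (gradient f (g t))).
Proof.
move=> df cdf cf sol t0 It.
have dg := solution_is_derive sol t0 It.
have cg := is_derive_continuous dg.
set G := gradient f (g t).
apply/is_derive_cvg => /=.
pose q (h : R) := h^-1 *: (g (t + h) - g t).
have /is_derive_cvg cq := dg.
have -> : - dot G G = dot G (- G).
  by rewrite -[- G]scaleN1r dotZr mulN1r.
pose A h := dot G (q h).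
pose B h := dot (gradient f (g (t + h))) (q h).
have cA : A h @[h --> 0^'] --> dot G (- G).
  by apply: cvg_dot => i; [exact: cvg_cst|exact: cvg_coord].
have cB : B h @[h --> 0^'] --> dot G (- G).
  apply: cvg_dot => i; last exact: cvg_coord.
  have -> : (fun h => gradient f (g (t + h)) 0 i) =
            (fun h => partial i f (g (t + h))).
    by apply/funext => h; rewrite mxE.
  rewrite [X in _ --> X]mxE.
  apply: (@cvg_shift_dnbhs _ _ (partial i f \o g)).
  by apply: continuous_comp => //; exact: cdf.
have cBA : `|B h - A h| @[h --> 0^'] --> 0.
  rewrite -[X in _ --> X](normr0 R) -[X in `|X|](subrr (dot G (- G))).
  by apply: cvg_norm; apply: cvgB.
apply: (@squeeze_cvgr _ _ _ _
  (fun h => A h - `|B h - A h|) (fun h => A h + `|B h - A h|)).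
(* The sign of h decides which of A and B is the lower bound; measuring the
   deviation from A by |B - A| treats both signs at once. *)
- near=> h.
  rewrite -ler_distl /B /A /q !dotZr /GRing.scale/= -!mulrBr !normrM.
  rewrite ler_wpM2l//.
  have lb := convex_gradient_le df cf (g t) (g (t + h)).
  have := convex_gradient_le df cf (g (t + h)) (g t).
  rewrite -[g t - _]opprB -scaleN1r dotZr mulN1r => ub.
  by rewrite !ger0_norm; lra.
- by rewrite -[X in _ --> X]subr0; apply: cvgB.
- by rewrite -[X in _ --> X]addr0; apply: cvgD.
Unshelve. all: by end_near. Qed.

Lemma continuous_sqr_dist (R : realType) (n : nat) (w : 'rV[R]_n) :
  continuous (fun v : 'rV[R]_n => dot (v - w) (v - w)).
Proof.
move=> v.
have c i : {for v, continuous (fun v' : 'rV[R]_n => (v' - w) 0 i)}.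
  have -> : (fun v' : 'rV[R]_n => (v' - w) 0 i) = (fun v' => v' 0 i - w 0 i).
    by apply/funext => v'; rewrite !mxE.
  by apply: continuousB; [exact: coord_continuous|exact: cst_continuous].
by apply: (@cvg_dot _ _ _ (nbhs v)) => i; exact: c.
Qed.

Lemma is_derive_sqr_dist (R : realType) (n : nat) (g : R -> 'rV[R]_n) (t : R)
    (v w : 'rV[R]_n) :
  is_derive t 1 g v ->
  is_derive t 1 (fun r => dot (g r - w) (g r - w)) (2 * dot v (g t - w)).
Proof.
move=> dg.
have cg := cvg_shift_dnbhs (is_derive_continuous dg).
have /is_derive_cvg cq := dg.
apply/is_derive_cvg.
have -> : 2 * dot v (g t - w) = dot v ((g t - w) + (g t - w)).
  by rewrite /dot mulr_sumr; apply: eq_bigr => i _; rewrite !mxE; ring.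
have -> : (fun h => h^-1 *: (dot (g (t + h) - w) (g (t + h) - w) -
                             dot (g t - w) (g t - w))) =
          (fun h => dot (h^-1 *: (g (t + h) - g t))
                        ((g (t + h) - w) + (g t - w))).
  apply/funext => h; rewrite /dot -sumrB /GRing.scale/= mulr_sumr.
  by apply: eq_bigr => i _; rewrite !mxE; ring.
apply: cvg_dot => i; first exact: cvg_coord.
apply: (@cvg_coord _ _ _ _ (fun h => (g (t + h) - w) + (g t - w))).
apply: cvgD; last exact: cvg_cst.
by apply: cvgB => //; exact: cvg_cst.
Qed.

(** The flow approaches every point [w] at which the value of [f] has not yet
    been passed.  This covers both the minimizer and the future points of the
    trajectory. *)
Lemma solution_dist_nonincreasing (R : realType) (f : 'rV[R]_2 -> R) T g w t :
  (forall i x, derivable f x (delta_mx 0 i)) ->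
  convex_function [set: 'rV[R]_2] f ->
  gradient_solution f T g -> forward_itv T t ->
  (forall r, 0 < r -> r < t -> f w <= f (g r)) ->
  forall s, 0 <= s -> s <= t ->
    euclidean_norm (g t - w) <= euclidean_norm (g s - w).
Proof.
move=> df cf sol It fw s s0 st; rewrite le_euclidean_norm.
pose l r := 2 * dot (- gradient f (g r)) (g r - w).
apply: (solution_lyapunov (l := l) sol (@continuous_sqr_dist _ _ w) It) => //.
move=> r r0 rt.
split.
  apply: is_derive_sqr_dist; apply: (solution_is_derive sol r0).
  exact: (forward_itv_le (ltW r0) (ltW rt) It).
have -> : l r = 2 * dot (gradient f (g r)) (w - g r).
  congr (_ * _); apply: eq_bigr => i _.
  by rewrite ![in LHS]mxE ![in RHS]mxE; ring.
by have := convex_gradient_le df cf (g r) w; have := fw r r0 rt; lra.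
Qed.

Lemma solution_value_nonincreasing (R : realType) (f : 'rV[R]_2 -> R) T g t :
  continuous f -> (forall i x, derivable f x (delta_mx 0 i)) ->
  (forall i, continuous (partial i f)) ->
  convex_function [set: 'rV[R]_2] f ->
  gradient_solution f T g -> forward_itv T t ->
  forall s, 0 <= s -> s <= t -> f (g t) <= f (g s).
Proof.
move=> cf0 df cdf cf sol It.
apply: (solution_lyapunov
  (l := fun r => - dot (gradient f (g r)) (gradient f (g r))) sol cf0 It).
move=> r r0 rt; split.
  apply: (is_derive_f_solution df cdf cf sol r0).
  exact: (forward_itv_le (ltW r0) (ltW rt) It).
by rewrite -sqr_euclidean_norm oppr_le0 sqr_ge0.
Qed.

Theorem theorem1p1 (R : realType) (f : 'rV[R]_2 -> R)
  (hsmooth : smooth f)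
  (hconvex : convex_function [set: 'rV[R]_2] f)
  (hmin : unique_minimum f)
  (T : \bar R) (gamma : R -> 'rV[R]_2)
  (hgamma : trajectory f T gamma) :
  (curve_length (forward_itv T) gamma < +oo)%E.
Proof.
have [cf hf] := hsmooth 1%N.
have df i x : derivable f x (delta_mx 0 i) by case: (hf i).
have cdf i : continuous (partial i f) by case: (hf i) => _ [].
have [sol _] := hgamma; have [x0 [minx0 _]] := hmin.
apply: (@self_contracted_bounded_length _ _ _ x0
  (euclidean_norm (gamma 0 - x0))).
- move=> s t u Is It Iu st tu.
  apply: (solution_dist_nonincreasing df hconvex sol It) => //.
    move=> r r0 rt.
    by apply: (solution_value_nonincreasing cf df cdf hconvex sol Iu); lra.
  by case: Is.
- move=> t It; have [t0 _] := It.
  by apply: (solution_dist_nonincreasing df hconvex sol It).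
Qed.
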